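(* If a complete separable metric space $M$ is universal for the class of complete countable discrete metric spaces and bi-Lipschitz embeddings, then $M$ is not purely 1-unrectifiable.
   Context: A metric space is discrete if each of its points is isolated. A metric space $(N,d_N)$ bi-Lipschitz embeds into $(M,d_M)$ if there are $s\in(0,\infty)$, $C\in[1,\infty)$ and $f:N\to M$ with $s\,d_N(x,y)\le d_M(f(x),f(y))\le sC\,d_N(x,y)$ for all $x,y\in N$. $M$ is universal for a class of metric spaces and bi-Lipschitz embeddings if every member of the class bi-Lipschitz embeds into $M$. A metric space is purely 1-unrectifiable if it contains no subset that is bi-Lipschitz equivalent to a compact subset of $\mathbb R$ of positive Lebesgue measure. *)

(* Defs.v *)
From HB Require Import structures.
From mathcomp Require Import all_boot all_order all_algebra.
From mathcomp Require Import all_classical all_reals all_analysis.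

Set Implicit Arguments.
Unset Strict Implicit.
Unset Printing Implicit Defensive.

Import Order.TTheory GRing.Theory Num.Theory.
Import numFieldNormedType.Exports.

Local Open Scope classical_set_scope.
Local Open Scope ring_scope.

(* The library's [completeType] requires a base point, which a [metricType]
   does not have; hence completeness as a predicate. *)
Definition complete_space (T : uniformType) : Prop :=
  forall F : set_system T, ProperFilter F -> cauchy F -> exists x : T, F --> x.

Definition separable_space (T : topologicalType) : Prop :=
  exists2 D : set T, countable D & dense D.

(* This is about the topology only: the distances between distinct points need
   not be bounded away from 0. *)
Definition discrete_space (T : topologicalType) : Prop :=
  forall x : T, isolated [set: T] x.

Definition bilipschitz_on (R : realType) (N M : metricType R)
    (A : set N) (f : N -> M) : Prop :=
  exists s C : R, [/\ 0 < s, 1 <= C &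
    forall x y : N, A x -> A y ->
      s * mdist x y <= mdist (f x) (f y) <= s * C * mdist x y].

Definition bilipschitz_embeds (R : realType) (N M : metricType R) : Prop :=
  exists f : N -> M, bilipschitz_on [set: N] f.

(* Only the values of [f] on [A] matter; that [f] is defined on all of [N] is
   no restriction as soon as [M] is inhabited. *)
Definition bilipschitz_equivalent (R : realType) (N M : metricType R)
    (A : set N) (B : set M) : Prop :=
  exists2 f : N -> M, bilipschitz_on A f & set_bij A B f.

Definition universal_for (R : realType) (P : metricType R -> Prop)
    (M : metricType R) : Prop :=
  forall N : metricType R, P N -> bilipschitz_embeds N M.

Definition complete_countable_discrete (R : realType) (N : metricType R) : Prop :=
  [/\ complete_space N, countable [set: N] & discrete_space N].

(* [R^o] is [R] with its distance [`|y - x|]. *)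
Definition purely_1_unrectifiable (R : realType) (M : metricType R) : Prop :=
  ~ exists (S : set M) (K : set R),
      [/\ compact K, (0 < lebesgue_measure K)%E &
          bilipschitz_equivalent S (K : set R^o)].

(* Main.v *)
Require Import Defs.
From HB Require Import structures.
From mathcomp Require Import all_boot all_order all_algebra.
From mathcomp Require Import all_classical all_reals all_analysis.
From mathcomp Require Import ring lra.

Set Implicit Arguments.
Unset Strict Implicit.
Unset Printing Implicit Defensive.

Import Order.TTheory GRing.Theory Num.Theory.
Import numFieldNormedType.Exports.

Local Open Scope classical_set_scope.
Local Open Scope ring_scope.

(**
A diagonal argument against the tree of finite approximations of a curve.

Let [r] be a sequence of reals each tail of which is dense in [1, 2), and [e]
a dense sequence of [M]. A branch of the tree [approx_tree r e] is a constant
[L] followed by points [a_0, a_1, ...] of the range of [e] such that the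
distance between [a_i] and [a_j] is comparable, up to the factor [L], to
[|r i - r j|], with an additive error [L (2^-i + 2^-j)] in the upper bound.
Since the errors vanish along the tails and [M] is complete, a branch extends
to a bi-Lipschitz map of [1, 2) into [M] ([bilipschitz_of_branch]), and the
image of [1, 3/2] shows that [M] is not purely 1-unrectifiable
([not_purely_1_unrectifiable_of_curve]). So it is enough to find a branch.

Every tree [T] of finite sequences of naturals is turned into a metric space
[tree_space r T] by

  dist u v = max (|r |u| - r |v||, 2 ^ (- length of the common prefix))

for distinct [u] and [v], where [|u|] is the length of [u]: a finite sequence
[u] sits over the point [r |u|] of the line, and above it in an ultrametric
direction. This space is countable, and discrete because the distance from [u]
to any other point is at least [2^-|u|]. A Cauchy filter without a limit has to
escape to longer and longer sequences, which agree on longer and longer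
prefixes; so the space is complete as soon as [T] has no infinite branch
([tree_space_complete]).

Suppose that [T = approx_tree r e] has no infinite branch. Then its tree space
embeds into [M] by universality, say by [F], with some constants. The images by
[F] of the successive prefixes of a node of [T] are spread like the points of a
curve fragment, so rounding them to the dense sequence [e] gives new letters
which, preceded by a large [L], form again a node of [T], longer than the node
that one started with. Hence the recursion [x 0 = L],
[x n.+1 = index of a point of e close to F (x 0, ..., x (n - 1))]
never leaves [T] and produces an infinite branch after all
([branch_of_embedding]).
*)

(** * Quadrangle inequalities and powers of one half *)

Lemma mdist_quad (R : realType) (M : metricType R) (y z y' z' : M) :
  mdist y z <= mdist y y' + mdist y' z' + mdist z z'.
Proof.
rewrite -addrA; apply: le_trans (metric_triangle y y' z) _.
rewrite lerD2l (metric_sym z); exact: metric_triangle.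
Qed.

Lemma ler_dist_quad (R : realType) (y z y' z' : R) :
  `|y - z| <= `|y - y'| + `|y' - z'| + `|z - z'|.
Proof.
rewrite -addrA; apply: le_trans (ler_distD y' _ _) _.
rewrite lerD2l (distrC z); exact: ler_distD.
Qed.

Section powers_of_one_half.
Context {R : realType}.

Lemma exp2V_gt0 n : 0 < 2 ^- n :> R.
Proof. by rewrite invr_gt0 exprn_gt0. Qed.

Lemma exp2V_le m n : (m <= n)%N -> 2 ^- n <= 2 ^- m :> R.
Proof.
by move=> mn; rewrite lef_pV2 ?posrE ?exprn_gt0// ler_weXn2l// ler1n.
Qed.

Lemma exp2V_lt_ex (e : R) : 0 < e -> exists k, 2 ^- k < e.
Proof.
move=> e0; have [k _ /(_ k (leqnn k))/=] :=
  near_infty_natSinv_expn_lt (PosNum e0).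
by rewrite div1r => ke; exists k.
Qed.

End powers_of_one_half.

(** * Longest common prefix of two sequences *)

Section longest_common_prefix.
Implicit Types u v w : seq nat.

Fixpoint lcp u v : nat :=
  match u, v with
  | x :: u', y :: v' => if x == y then (lcp u' v').+1 else 0%N
  | _, _ => 0%N
  end.

(** The universal property of [lcp], from which symmetry and the ultrametric
    inequality are read off. *)
Lemma leq_lcp n u v :
  (n <= lcp u v)%N = [&& (n <= size u)%N, (n <= size v)%N & take n u == take n v].
Proof.
elim: n u v => [|n IH] [|x u] [|y v] //=.
- by rewrite !andbF.
- rewrite eqseq_cons; case: eqVneq => /= _; last by rewrite !andbF.
  by rewrite !ltnS IH.
Qed.

Lemma lcpC u v : lcp u v = lcp v u.
Proof.
by apply/eqP; rewrite eqn_leq !leq_lcp;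
   have := leqnn (lcp u v); rewrite leq_lcp => /and3P[-> -> /eqP->];
   have := leqnn (lcp v u); rewrite leq_lcp => /and3P[-> -> /eqP->]; rewrite !eqxx.
Qed.

Lemma lcp_size u v : (lcp u v <= size u)%N.
Proof. by have := leqnn (lcp u v); rewrite leq_lcp => /and3P[]. Qed.

Lemma lcp_min u v w : (minn (lcp u v) (lcp v w) <= lcp u w)%N.
Proof.
have := geq_minl (lcp u v) (lcp v w); rewrite leq_lcp => /and3P[nu _ /eqP uv].
have := geq_minr (lcp u v) (lcp v w); rewrite leq_lcp => /and3P[_ nw /eqP vw].
by rewrite leq_lcp nu nw uv vw eqxx.
Qed.

End longest_common_prefix.

(** * The metric space of a tree of finite sequences *)

Section tree_distance.
Context {R : realType}.
Variable r : nat -> R.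
Implicit Types u v w : seq nat.

Definition tree_dist u v : R :=
  if u == v then 0
  else Num.max `|r (size u) - r (size v)| (2 ^- lcp u v).

Lemma tree_distxx u : tree_dist u u = 0.
Proof. by rewrite /tree_dist eqxx. Qed.

Lemma tree_dist_ge_lcp u v : u != v -> 2 ^- lcp u v <= tree_dist u v.
Proof. by rewrite /tree_dist => /negPf->; rewrite le_max lexx orbT. Qed.

Lemma tree_dist_ge_size u v : u != v -> 2 ^- size u <= tree_dist u v.
Proof.
by move=> /tree_dist_ge_lcp; apply: le_trans; exact/exp2V_le/lcp_size.
Qed.

Lemma tree_dist_ge_level u v : `|r (size u) - r (size v)| <= tree_dist u v.
Proof.
rewrite /tree_dist; case: eqVneq => [->|_]; first by rewrite subrr normr0.
by rewrite le_max lexx.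
Qed.

Lemma tree_dist_ge0 u v : 0 <= tree_dist u v.
Proof. exact: le_trans (tree_dist_ge_level u v). Qed.

Lemma tree_dist0 u v : tree_dist u v = 0 -> u = v.
Proof.
move=> uv0; apply/eqP/negP => /negP/tree_dist_ge_lcp.
by rewrite uv0 leNgt exp2V_gt0.
Qed.

Lemma tree_distC u v : tree_dist u v = tree_dist v u.
Proof. by rewrite /tree_dist eq_sym distrC lcpC. Qed.

Lemma tree_dist_triangle v u w :
  tree_dist u w <= tree_dist u v + tree_dist v w.
Proof.
have [->|uv] := eqVneq u v; first by rewrite tree_distxx add0r.
have [->|vw] := eqVneq v w; first by rewrite tree_distxx addr0.
rewrite {1}/tree_dist; case: eqVneq => _.
  by rewrite addr_ge0// tree_dist_ge0.
rewrite ge_max; apply/andP; split.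
  apply: le_trans (ler_distD (r (size v)) _ _) _.
  by rewrite lerD// tree_dist_ge_level.
have := tree_dist_ge_lcp uv; have := tree_dist_ge_lcp vw.
have := exp2V_le (R := R) (lcp_min u v w).
have := exp2V_gt0 (R := R) (lcp u v); have := exp2V_gt0 (R := R) (lcp v w).
by rewrite /minn; case: ifP => _; lra.
Qed.

(** The length of the common prefix is an integer, which gives one more common
    letter than the [n] that the bound suggests; a Cauchy filter thus determines
    the letter of index [n] at scale [2^-n]. *)
Lemma tree_dist_lt_take n u v :
  tree_dist u v < 2 ^- n -> take n.+1 u = take n.+1 v.
Proof.
have [-> //|uv] := eqVneq u v; move=> /(le_lt_trans (tree_dist_ge_lcp uv)) luv.
have : (n.+1 <= lcp u v)%N.
  by rewrite ltnNge; apply/negP => /(exp2V_le (R := R)); rewrite leNgt luv.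
by rewrite leq_lcp => /and3P[_ _ /eqP].
Qed.

(** Along a single branch the ultrametric part of the distance is only an error
    term, which vanishes at infinity: what remains is the distance on the line. *)
Lemma tree_dist_prefixes (x : nat -> nat) i j :
  tree_dist (mkseq x i) (mkseq x j) <= `|r i - r j| + 2 ^- i + 2 ^- j.
Proof.
have i0 := exp2V_gt0 (R := R) i; have j0 := exp2V_gt0 (R := R) j.
rewrite /tree_dist; case: eqVneq => _; first by rewrite !addr_ge0// ltW.
rewrite !size_mkseq ge_max -addrA lerDl addr_ge0 ?(ltW i0) ?(ltW j0)//=.
have : (minn i j <= lcp (mkseq x i) (mkseq x j))%N.
  rewrite leq_lcp !size_mkseq geq_minl geq_minr /=.
  by rewrite /mkseq -!map_take !take_iota (minn_idPl (geq_minl i j))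
             (minn_idPl (geq_minr i j)).
move=> /(exp2V_le (R := R)) /le_trans; apply.
have := normr_ge0 (r i - r j).
by rewrite /minn; case: ifP => _; lra.
Qed.

End tree_distance.

(** [R] and [r] are phantom parameters, which let the metric depend on [r]. *)
Definition tree_space (R : realType) (r : nat -> R) (T : set (seq nat)) : Type :=
  {u : seq nat | `[< T u >]}.

HB.instance Definition _ (R : realType) (r : nat -> R) (T : set (seq nat)) :=
  Countable.on (tree_space r T).

Section tree_space_metric.
Context {R : realType}.
Variables (r : nat -> R) (T : set (seq nat)).

Let dist (p q : tree_space r T) := tree_dist r (val p) (val q).

Let dist_xx p : dist p p = 0. Proof. exact: tree_distxx. Qed.

Let dist_0 p q : dist p q = 0 -> p = q.
Proof. by move=> /tree_dist0/val_inj. Qed.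

Let dist_C p q : dist p q = dist q p. Proof. exact: tree_distC. Qed.

Let dist_triangle q p s : dist p s <= dist p q + dist q s.
Proof. exact: tree_dist_triangle. Qed.

HB.instance Definition _ := isMetric.Build R (tree_space r T)
  dist_xx dist_0 dist_C dist_triangle.

Lemma tree_space_mdistE (p q : tree_space r T) :
  mdist p q = tree_dist r (val p) (val q).
Proof. by []. Qed.

Lemma tree_space_countable : countable [set: tree_space r T].
Proof. exact: countableP. Qed.

Lemma tree_space_ball (p : tree_space r T) n :
  (size (val p) <= n)%N -> ball p (2 ^- n) = [set p].
Proof.
move=> pn; apply/seteqP; split=> [q|_ ->]; last exact: ballxx (exp2V_gt0 n).
rewrite ballEmdist/= tree_space_mdistE; apply: contraPeq => qp.
apply/negP; rewrite -leNgt (le_trans (exp2V_le pn))// tree_dist_ge_size//.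
by rewrite (inj_eq val_inj) eq_sym.
Qed.

Lemma tree_space_discrete : discrete_space (tree_space r T).
Proof.
move=> p; split; first by rewrite inE.
exists (ball p (2 ^- size (val p))); first exact: nbhsx_ballx (exp2V_gt0 _).
by rewrite setIT tree_space_ball.
Qed.

(** For each [n], a Cauchy filter contains a ball of radius [2^-n] centred at some
    [p n]. If [p n] has length at most [n], this ball is reduced to its centre,
    which is then the limit. Otherwise the prefixes of length [n] of the [p n]
    are compatible, because any two members of the filter meet, and they make up
    a branch. *)
Lemma tree_space_complete : (forall u n, T u -> T (take n u)) ->
  ~ (exists x : nat -> nat, forall n, T (mkseq x n)) ->
  complete_space (tree_space r T).
Proof.
move=> Tpre nobranch F PF /(cauchyP F) cF.
have /choice[p Fp] n : exists p : tree_space r T, F (ball p (2 ^- n)).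
  exact/cF/exp2V_gt0.
apply: contrapT => nlim; apply: nobranch.
have long n : (n < size (val (p n)))%N.
  rewrite ltnNge; apply/negP => pn; apply: nlim; exists (p n).
  move=> A /nbhs_singleton Apn.
  by apply: filterS (Fp n); rewrite tree_space_ball// => _ ->.
have pE m n : (m <= n)%N -> take m.+1 (val (p m)) = take m.+1 (val (p n)).
  move=> mn; have [q []] := filter_ex (filterI (Fp m) (Fp n)).
  rewrite !ballEmdist/= !tree_space_mdistE.
  move=> /tree_dist_lt_take-> /tree_dist_lt_take/(congr1 (take m.+1)).
  by rewrite !take_takel// ltnS.
exists (fun n => nth 0%N (val (p n)) n) => n.
have -> : mkseq (fun k => nth 0%N (val (p k)) k) n = take n (val (p n)).
  apply: (@eq_from_nth _ 0%N); rewrite size_mkseq ?size_takel// ?(ltnW (long n))//.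
  move=> i ni; rewrite nth_mkseq// nth_take//.
  rewrite -(nth_take 0%N (ltnSn i) (val (p i))) (pE _ _ (ltnW ni)).
  by rewrite nth_take.
by apply: Tpre; apply/asboolP; exact: valP (p n).
Qed.

End tree_space_metric.

(** * The tree of approximate curve fragments *)

Section approximation_tree.
Context {R : realType} {M : metricType R}.
Variables (r : nat -> R) (e : nat -> M).

(** The lower bound carries no error term: [tree_dist] dominates both [|r i - r j|]
    and the rounding errors, so that the lower bound of an embedding survives
    rounding up to a factor. *)
Definition level_bilipschitz (L : R) (i j : nat) (y z : M) : Prop :=
  `|r i - r j| <= L * mdist y z /\
  mdist y z <= L * (`|r i - r j| + 2 ^- i + 2 ^- j).

(** The first letter of a node encodes the constant, as its successor, so that one
    tree deals with all bi-Lipschitz constants at once; the letter of index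
    [i.+1] is the index in [e] of the point of level [i]. *)
Definition approx_tree : set (seq nat) := fun u =>
  forall i j, (i.+1 < size u)%N -> (j.+1 < size u)%N ->
    level_bilipschitz (head 0%N u).+1%:R i j
      (e (nth 0%N u i.+1)) (e (nth 0%N u j.+1)).

Lemma approx_tree_take u n : approx_tree u -> approx_tree (take n u).
Proof.
move=> Tu i j; rewrite !size_take_min !leq_min => /andP[ni ui] /andP[nj uj].
rewrite !nth_take// -nth0 nth_take ?nth0; last by case: n ni nj.
exact: Tu.
Qed.

(** The branch feeds on itself: its letter of index [n.+1] is read off from the
    image under the embedding of its own prefix of length [n]. Membership of that
    prefix of length [n] in the tree is all that is needed to see that the prefix
    of length [n.+2] is in the tree. *)
Lemma branch_of_embedding :
  (forall y d, 0 < d -> exists n, mdist y (e n) < d) ->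
  bilipschitz_embeds (tree_space r approx_tree) M ->
  exists x : nat -> nat, forall n, approx_tree (mkseq x n).
Proof.
move=> e_dense [F [s [C [s0 C1 FE]]]].
have root : tree_space r approx_tree by exists [::]; apply/asboolP.
pose f u := F (insubd root u).
have fE u v : approx_tree u -> approx_tree v ->
    s * tree_dist r u v <= mdist (f u) (f v) <= s * C * tree_dist r u v.
  move=> Tu Tv; have := FE (insubd root u) (insubd root v) I I.
  by rewrite tree_space_mdistE !insubdK//; exact/asboolP.
(* A node of length [k] is at distance at least [2^-k] from the other nodes; at
   precision [s / 4 * 2^-k], rounding both ends of a pair costs at most half of
   the lower bound [s * tree_dist]. *)
have /choice[a aE] u : exists n, mdist (f u) (e n) < s / 4 * 2 ^- size u.
  by apply: e_dense; rewrite mulr_gt0 ?exp2V_gt0// divr_gt0.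
pose L := Num.bound (2 / s + s * C + s).
have L_ge : 2 / s + s * C + s <= L.+1%:R.
  apply: le_trans (ltW (archi_boundP _)) _; last by rewrite ler_nat.
  by rewrite !addr_ge0 ?mulr_ge0 ?invr_ge0 ?(ltW s0)//; lra.
have sC0 : 0 <= s * C by rewrite mulr_ge0 ?(ltW s0)//; lra.
have s20 : 0 <= 2 / s by rewrite divr_ge0 ?(ltW s0).
(* [U n] is the prefix of length [n.+1] of the branch; the next letter only looks
   at its first [n] letters. *)
pose U := fix U n :=
  if n is n'.+1 then rcons (U n') (a (take n' (U n'))) else [:: L].
pose x n := last 0%N (U n).
have UE n : U n = mkseq x n.+1.
  by elim: n => [//|n IH]; rewrite mkseqS -IH /x/= last_rcons.
have xS n : x n.+1 = a (mkseq x n).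
  by rewrite /x/= last_rcons UE mkseqS -cats1 take_size_cat// size_mkseq.
exists x; elim=> [//|n IHn].
(* The letters up to index [n.+1] depend on prefixes of length at most [n], so the
   prefix of length [n.+2] is within reach; it is one longer than required. *)
have -> : mkseq x n.+1 = take n.+1 (mkseq x n.+2).
  by rewrite (mkseqS x n.+1) -cats1 take_size_cat// size_mkseq.
apply: approx_tree_take => i j; rewrite size_mkseq => ni nj.
rewrite !nth_mkseq// [head _ _]/= -/L !xS.
have Tx k : (k <= n)%N -> approx_tree (mkseq x k).
  move=> kn; rewrite /mkseq -(minn_idPl kn) -take_iota map_take.
  exact: approx_tree_take.
have /andP[FL FU] := fE _ _ (Tx i ni) (Tx j nj).
have := aE (mkseq x i); have := aE (mkseq x j); rewrite !size_mkseq.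
set y := e (a (mkseq x i)); set z := e (a (mkseq x j)) => az ay.
have tU := tree_dist_prefixes r x i j.
have i0 := exp2V_gt0 (R := R) i; have j0 := exp2V_gt0 (R := R) j.
rewrite /level_bilipschitz.
set pi := 2 ^- i in i0 tU ay *; set pj := 2 ^- j in j0 tU az *.
set td := tree_dist _ _ _ in FL FU tU.
have tD : `|r i - r j| <= td.
  by have := tree_dist_ge_level r (mkseq x i) (mkseq x j); rewrite !size_mkseq.
have lower := mdist_quad (f (mkseq x i)) (f (mkseq x j)) y z.
have upper := mdist_quad y z (f (mkseq x i)) (f (mkseq x j)).
rewrite (metric_sym y (f _)) (metric_sym z (f _)) in upper.
split.
  have [->|ij] := eqVneq i j.
    by rewrite subrr normr0 mulr_ge0// mdist_ge0.
  have mij : mkseq x i != mkseq x j.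
    by apply: contra_neq ij => /(congr1 size); rewrite !size_mkseq.
  have := tree_dist_ge_size r mij; rewrite size_mkseq -/td -/pi => ti.
  have := mij; rewrite eq_sym => /(tree_dist_ge_size r).
  rewrite tree_distC size_mkseq -/td -/pj => tj.
  have s40 : 0 <= s / 4 by lra.
  have := ler_wpM2l s40 ti; have := ler_wpM2l s40 tj => stj sti.
  have std : s * td <= 2 * mdist y z by lra.
  apply: le_trans tD _; apply: le_trans (_ : 2 / s * mdist y z <= _).
    by rewrite mulrAC ler_pdivlMr// mulrC.
  by apply: ler_wpM2r; [exact: mdist_ge0|lra].
have D0 : 0 <= `|r i - r j| by [].
have sD : 0 <= s * `|r i - r j| by rewrite mulr_ge0// ltW.
have si : 0 <= s * pi by rewrite mulr_ge0// ltW.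
have sj : 0 <= s * pj by rewrite mulr_ge0// ltW.
have sCtd := ler_wpM2l sC0 tU.
apply: le_trans (_ : (s * C + s) * (`|r i - r j| + pi + pj) <= _).
  by rewrite mulrDl [s * (_ + _ + _)]mulrDr [s * (_ + _)]mulrDr; lra.
by apply: ler_wpM2r; [lra|lra].
Qed.

End approximation_tree.

(** * From a branch to a curve fragment *)

Section curve_fragment.
Context {R : realType}.

(** The value at [t] is a limit of the points [a i] along indices [i] going to
    infinity with [r i] tending to [t]; the errors [2^-i] disappear in the limit.
    Density of every tail of [r] provides such indices. *)
Lemma bilipschitz_of_branch (M : metricType R) (r : nat -> R) (a : nat -> M)
    (L : R) (K : set R) :
  complete_space M -> 0 < L ->
  (forall t, K t -> forall k, exists2 i, (k <= i)%N & `|r i - t| <= 2 ^- k) ->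
  (forall i j, level_bilipschitz r L i j (a i) (a j)) ->
  exists g : R -> M, forall t t', K t -> K t' ->
    `|t - t'| <= L * mdist (g t) (g t') /\ mdist (g t) (g t') <= L * `|t - t'|.
Proof.
move=> cM L0 rK aL.
(* Both bounds pass to the limit from this form of closeness, without reference to
   the subsequence that was used to construct the limit. *)
pose limit_at t y := forall d, 0 < d ->
  exists i, [/\ 2 ^- i <= d, `|r i - t| <= d & mdist y (a i) <= d].
have /choice[g gE] : forall t, exists y, K t -> limit_at t y.
  move=> t; have [Kt|nKt] := pselect (K t); last by exists (a 0%N).
  have /choice[i iE] : forall k, exists i, (k <= i)%N /\ `|r i - t| <= 2 ^- k.
    by move=> k; have [i ki rit] := rK t Kt k; exists i.
  have [|y ay] := cM (a \o i @ \oo) _.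
    apply/cauchyP => d d0.
    have [k kd] := exp2V_lt_ex (divr_gt0 d0 (mulr_gt0 (ltr0n R 4) L0)).
    exists (a (i k)); exists k => //= l /= kl; rewrite ballEmdist/=.
    apply: le_lt_trans (aL (i k) (i l)).2 _.
    rewrite mulrC -ltr_pdivlMr//.
    have [ik rk] := iE k; have [il rl] := iE l.
    have := exp2V_le (R := R) ik; have := exp2V_le (R := R) (leq_trans kl il).
    have := exp2V_le (R := R) kl => lk ilk ikk.
    have := ler_distD t (r (i k)) (r (i l)); rewrite (distrC t) => tri.
    by move: kd; rewrite invfM mulrA [d / 4 / L]mulrAC; lra.
  exists y => _ d d0.
  have [k0 k0d] := exp2V_lt_ex d0.
  have /cvg_ballP /(_ d d0)[k1 _ k1P] := ay.
  pose k := maxn k0 k1; exists (i k); split.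
  - apply: le_trans (ltW k0d); apply: exp2V_le.
    by apply: leq_trans (leq_maxl k0 k1) _; exact: (iE k).1.
  - apply: le_trans (iE k).2 (le_trans _ (ltW k0d)).
    exact/exp2V_le/leq_maxl.
  - by have := k1P k (leq_maxr k0 k1); rewrite ballEmdist => /ltW.
exists g => t t' /gE gt /gE gt'.
have close d : 0 < d -> exists i j, [/\
    `|r i - r j| <= `|t - t'| + 2 * d, `|t - t'| <= `|r i - r j| + 2 * d,
    mdist (a i) (a j) <= mdist (g t) (g t') + 2 * d,
    mdist (g t) (g t') <= mdist (a i) (a j) + 2 * d & 2 ^- i + 2 ^- j <= 2 * d].
  move=> d0; have [i [id rid gid]] := gt d d0; have [j [jd rjd gjd]] := gt' d d0.
  have lower := mdist_quad (a i) (a j) (g t) (g t').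
  have upper := mdist_quad (g t) (g t') (a i) (a j).
  rewrite (metric_sym (a i) (g _)) (metric_sym (a j) (g _)) in lower.
  have rlower := ler_dist_quad (r i) (r j) t t'.
  have rupper := ler_dist_quad t t' (r i) (r j).
  rewrite (distrC t (r i)) (distrC t' (r j)) in rupper.
  by exists i, j; split; lra.
(* [4 * (L * d) + 2 * d] is the total error in the upper bound below, and it
   dominates the error [2 * (L * d) + 2 * d] of the lower bound. *)
have dE eps : 0 < eps -> exists2 d, 0 < d & 4 * (L * d) + 2 * d = eps.
  move=> eps0; have L20 : 0 < 4 * L + 2 by lra.
  by exists (eps / (4 * L + 2)); [exact: divr_gt0|field; lra].
split; apply/ler_addgt0Pr => _ /dE[d d0 <-];
  have [i [j [rt tr ag ga ij]]] := close d d0; have [lo up] := aL i j;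
  have Ld : 0 < L * d by rewrite mulr_gt0.
- by have := ler_wpM2l (ltW L0) ag; rewrite mulrDr; lra.
- have : `|r i - r j| + 2 ^- i + 2 ^- j <= `|t - t'| + 4 * d by lra.
  by move=> /(ler_wpM2l (ltW L0)); rewrite mulrDr; lra.
Qed.

(** The definition asks for a map from the curve to the line, that is, for the
    inverse [h] of [g], extended arbitrarily outside the curve. *)
Lemma not_purely_1_unrectifiable_of_curve (M : metricType R) (g : R -> M)
    (L b c : R) :
  0 < L -> b < c ->
  (forall t t', b <= t <= c -> b <= t' <= c ->
    `|t - t'| <= L * mdist (g t) (g t') /\ mdist (g t) (g t') <= L * `|t - t'|) ->
  ~ purely_1_unrectifiable M.
Proof.
move=> L0 bc gE; apply.
pose K := `[b, c]%classic : set R.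
have KP t : K t -> b <= t <= c by rewrite /K /= in_itv.
have g_inj t t' : K t -> K t' -> g t = g t' -> t = t'.
  move=> /KP Kt /KP Kt' gtt'; have [+ _] := gE _ _ Kt Kt'.
  rewrite gtt' mdistxx mulr0 normr_le0 subr_eq0 => /eqP//.
have /choice[h hE] : forall y, exists t, (g @` K) y -> K t /\ g t = y.
  move=> y; have [[t Kt gty]|ny] := pselect ((g @` K) y); last by exists 0.
  by exists t.
exists (g @` K), K; split; first exact: segment_compact.
  by rewrite lebesgue_measure_itv/= lte_fin bc -EFinB lte_fin subr_gt0.
exists (h : M -> R^o).
  exists L^-1, (Num.max 1 (L ^+ 2)); split; first by rewrite invr_gt0.
    by rewrite le_max lexx.
  move=> y z /hE[Ky gy] /hE[Kz gz].
  have [] := gE _ _ (KP _ Ky) (KP _ Kz); rewrite gy gz => lo up.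
  have -> : mdist (h y : R^o) (h z : R^o) = `|h y - h z| by exact: distrC.
  rewrite ler_pdivrMl// up/=; apply: le_trans lo _.
  apply: ler_wpM2r; first exact: mdist_ge0.
  by rewrite ler_pdivlMl// -expr2 le_max lexx orbT.
split=> [y /hE[]//|y z|t Kt].
  by rewrite !inE => /hE[_ {2}<-] /hE[_ {2}<-] ->.
have gKt : (g @` K) (g t) by exists t.
have [Kh ght] := hE _ gKt.
by exists (g t) => //; exact: g_inj ght.
Qed.

End curve_fragment.

(** * A sequence of reals with dense tails *)

Section dyadic_sequence.
Context {R : realType}.

(** While [i] runs over the block from [2^k] to [2^k.+1 - 1], these values run over
    a net of mesh [2^-k] of [1, 2). *)
Definition dyadic (i : nat) : R := i%:R / 2 ^+ trunc_log 2 i.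

Lemma dyadic_dense (t : R) k : 1 <= t < 2 ->
  exists2 i, (k <= i)%N & `|dyadic i - t| <= 2 ^- k.
Proof.
move=> /andP[t1 t2].
have p0 : 0 < 2 ^+ k :> R by rewrite exprn_gt0.
pose i := Num.truncn (2 ^+ k * t).
have /truncn_itv/andP[ile ilt] : 0 <= 2 ^+ k * t.
  by rewrite mulr_ge0 ?(ltW p0)//; lra.
have ki : (2 ^ k <= i < 2 ^ k.+1)%N.
  apply/andP; split.
    by rewrite -ltnS -(ltr_nat R) natrX (le_lt_trans _ ilt)// ler_peMr// ltW.
  rewrite -(ltr_nat R) natrX.
  by apply: le_lt_trans ile _; rewrite exprSr ltr_pM2l.
exists i; first by case/andP: ki => /(leq_trans (ltnW (ltn_expl k (ltnSn 1)))).
rewrite /dyadic (trunc_log_eq _ ki)// ler_norml.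
have it : i%:R / 2 ^+ k <= t by rewrite ler_pdivrMr// mulrC.
have ti : t <= i%:R / 2 ^+ k + 2 ^- k.
  by rewrite -{2}[2 ^- k]mul1r -mulrDl natr1 ler_pdivlMr// mulrC ltW.
by move: (exp2V_gt0 (R := R) k) it ti; set x := i%:R / _; set y := 2 ^- k; lra.
Qed.

End dyadic_sequence.

(** * The theorem *)

Lemma dense_sequence (R : realType) (M : metricType R) (y0 : M) :
  separable_space M ->
  exists e : nat -> M, forall y d, 0 < d -> exists n, mdist y (e n) < d.
Proof.
move=> [D /countable_injP[c c_inj] dD].
have /choice[e eE] n : exists y, (exists2 z, D z & c z = n) -> D y /\ c y = n.
  have [[z Dz cz]|no] := pselect (exists2 z, D z & c z = n); last by exists y0.
  by exists z.
exists e => y d d0.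
have [|z [/= + Dz]] := dD (ball y d)^°%classic _ (@open_interior _ _).
  exists y; exact: nbhsx_ballx.
move=> /interior_subset; rewrite ballEmdist/= => yz.
exists (c z); have [De ce] := eE (c z) (ex_intro2 _ _ z Dz erefl).
by rewrite (c_inj _ _ _ _ ce) ?inE.
Qed.

Theorem corollary4p7 (R : realType) (M : metricType R)
    (complete_M : complete_space M) (separable_M : separable_space M)
    (universal_M : universal_for (@complete_countable_discrete R) M) :
  ~ purely_1_unrectifiable M.
Proof.
have embeds T : (forall u n, T u -> T (take n u)) ->
    ~ (exists x : nat -> nat, forall n, T (mkseq x n)) ->
    bilipschitz_embeds (tree_space (@dyadic R) T) M.
  move=> Tpre nobranch; apply: universal_M; split.
  - exact: tree_space_complete.
  - exact: tree_space_countable.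
  - exact: tree_space_discrete.
(* The one-point space shows that [M] is inhabited. *)
have [y0 _] : exists y : M, True.
  have [||F _] := embeds [set [::]].
  - by move=> _ n ->.
  - by move=> [x /(_ 1%N)].
  have root : tree_space (@dyadic R) [set [::]] by exists [::]; apply/asboolP.
  by exists (F root).
have [e e_dense] := dense_sequence y0 separable_M.
have [x xT] : exists x : nat -> nat,
    forall n, approx_tree (@dyadic R) e (mkseq x n).
  apply: contrapT => nobranch; apply: (nobranch).
  apply: branch_of_embedding e_dense (embeds _ _ nobranch).
  exact: approx_tree_take.
have [||i j|g gE] := @bilipschitz_of_branch R M (@dyadic R)
  (fun i => e (x i.+1)) (x 0%N).+1%:R [set t | 1 <= t < 2] complete_M.
- exact: ltr0Sn.
- by move=> t /= t12 k; exact: dyadic_dense.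
- have := xT (maxn i j).+2 i j; rewrite size_mkseq !ltnS leq_maxl leq_maxr.
  rewrite !nth_mkseq ?ltnS ?leq_maxl ?leq_maxr// [head _ _]/=.
  by apply.
(* Density holds on [1, 2), whereas the definition asks for a compact set: any
   compact subinterval will do. *)
apply: (@not_purely_1_unrectifiable_of_curve R M g (x 0%N).+1%:R 1 (3 / 2)) => //.
  by lra.
by move=> t t' t1 t1'; apply: gE => /=; lra.
Qed.
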